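(* There is a real random variable $\Gamma_C>0$ on $(\Theta,\mathcal T,\mathcal P)$, independent of (i.e. not depending on) $x\in\mathbb R^3$ and $\mathcal S\in\mathcal C_{\mathcal S}$, with $$E\{\Gamma_C^2\}<+\infty,\qquad E\{\Gamma_C^4\}<+\infty ,$$ such that for every $\mathcal S\in\mathcal C_{\mathcal S}$ the non-Gaussian $\mathbb M_6^+$-valued random field $\{[C(x;\mathcal S)],x\in\mathbb R^3\}$ defined in the context is a second-order random field and satisfies $$\|[C(x;\mathcal S)]\|_F\le \Gamma_C\quad\text{a.s.},\qquad \forall x\in\mathbb R^3,$$ and, for all $\omega,\omega'\in\mathbb R^6$ and all $x\in\mathbb R^3$, $$|\langle [C(x;\mathcal S)]\,\omega,\omega'\rangle_2|\le \Gamma_C\,\|\omega\|_2\,\|\omega'\|_2\quad\text{a.s.}$$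
   Context: Notation: $\mathbb M_6^+$ is the set of symmetric positive-definite real $6\times 6$ matrices; $\|\cdot\|_F$ is the Frobenius norm; $\langle\cdot,\cdot\rangle_2,\|\cdot\|_2$ are the Euclidean inner product and norm; $E$ is expectation on the probability space $(\Theta,\mathcal T,\mathcal P)$. A matrix-valued random field is second-order if $E\{\|[C(x)]\|_F^2\}<\infty$ for all $x$. Spectral discretization. Let $\nu_s\ge 2$ be an even integer, $\nu=\nu_s^3$, $\widehat\nu_s=\nu_s/2$, $\mathcal B=\{1,\dots,\nu_s\}^3$, $\widehat{\mathcal B}=\{1,\dots,\widehat\nu_s\}^3\subset\mathcal B$. For $\beta=(\beta_1,\beta_2,\beta_3)\in\mathcal B$ let $\tau_\beta=(\tau_{\beta_1},\tau_{\beta_2},\tau_{\beta_3})$ with $\tau_{\beta_j}=-1+(\beta_j-\tfrac12)\tfrac{2}{\nu_s}$. Let $\chi:\mathbb R^3\to\mathbb R^+$ be continuous with compact support $[-1,1]^3$, $\int_{\mathbb R^3}\chi=1$, $\chi(-\tau)=\chi(\tau)$, and invariant under the change of sign of any one coordinate (quadrant symmetry). Put $\chi^\Delta_\beta=(2/\nu_s)^3\chi(\tau_\beta)$. The integer $\nu_s$ is fixed and large enough that $|\sum_{\beta\in\mathcal B}\chi^\Delta_\beta-1|\le\epsilon_s$ for a fixed small $\epsilon_s\in(0,1)$. Parameterization. $\mathcal C_y$ is the set of real $3\times\widehat\nu_s$ matrices with all entries in $[0,1]$; $[\underline y]\in\mathcal C_y$ has all entries $1/2$. For $\widehat\beta\in\widehat{\mathcal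 B}$, $a_{\widehat\beta}([y])=\sqrt{\chi^\Delta_{\widehat\beta}}\;q_{\widehat\beta}([y];\delta_s)$, where $\delta_s>0$ is fixed and $q_{\widehat\beta}(\cdot;\delta_s):\mathcal C_y\to\mathbb R$ is a given continuous function with $q_{\widehat\beta}([\underline y];\delta_s)=1$. This is extended to $\beta\in\mathcal B$ by quadrant symmetry: $a_\beta=a_{\widehat\beta}$ with $\widehat\beta_j=\min(\beta_j,\nu_s+1-\beta_j)$. It is assumed that $\sum_{\beta'\in\mathcal B}a_{\beta'}([y])^2>0$ for all $[y]\in\mathcal C_y$, and $\widetilde\chi^\Delta_\beta([y])=a_\beta([y])^2\big(\sum_{\beta'\in\mathcal B}a_{\beta'}([y])^2\big)^{-1}$. Let $\mathcal C_w=\prod_{j=1}^3[w_j^{\min},w_j^{\max}]$ with $0<w_j^{\min}<w_j^{\max}<+\infty$, and $\mathcal C_{\mathcal S}=\mathcal C_w\times\mathcal C_y$, with elements $\mathcal S=\{w,[y]\}$. Gaussian germs. For $z,\varphi\in\mathbb R^\nu$ indexed by $\mathcal B$, set $$g^\nu(x;\mathcal S,z,\varphi)=\sum_{\beta\in\mathcal B}\sqrt{2\widetilde\chi^\Delta_\beta([y])}\;z_\beta\cos\Big(\varphi_\beta+\sum_{j=1}^3\frac{\pi}{w_j}\tau_{\beta_j}x_j\Big).$$ Let $Z=(Z_\beta)_{\beta\in\mathcal B}$, $\Phi=(\Phi_\beta)_{\beta\in\mathcal B}$ consist of $2\nu$ independent random variables, with $Z_\beta=\sqrt{-\log\Psi_\beta}$,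 $\Psi_\beta$ uniform on $[0,1]$, $\Phi_\beta$ uniform on $[0,2\pi]$. Let $\{Z^{mn},\Phi^{mn}\}_{1\le m\le n\le 6}$ be $21$ independent copies of $(Z,\Phi)$ on $(\Theta,\mathcal T,\mathcal P)$ and $G^\nu_{mn}(x;\mathcal S)=g^\nu(x;\mathcal S,Z^{mn},\Phi^{mn})$. Random field $[C]$. Fix $\delta_c\in\,]0,\sqrt{7/11}[$, $\sigma_c=\delta_c/\sqrt7$, $\alpha_m=\frac{1}{2\sigma_c^2}+\frac{1-m}{2}$ for $m=1,\dots,6$ (so $\alpha_m>3$). For $\alpha>3$, $b\in\mathbb R$, $h(b;\alpha)=F_\alpha^{-1}(F(b))$, where $F$ is the standard normal c.d.f. and $F_\alpha(\gamma)=\Gamma(\alpha)^{-1}\int_0^\gamma t^{\alpha-1}e^{-t}dt$. Then $[C(x;\mathcal S)]=[L(x;\mathcal S)]^T[L(x;\mathcal S)]$ with $[L(x;\mathcal S)]$ upper triangular $6\times 6$, $[L(x;\mathcal S)]_{mn}=\sigma_c G^\nu_{mn}(x;\mathcal S)$ for $m<n$ and $[L(x;\mathcal S)]_{mm}=\sigma_c\sqrt{2\,h(G^\nu_{mm}(x;\mathcal S);\alpha_m)}$. *)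

(* Defs.v *)
From HB Require Import structures.
From mathcomp Require Import all_boot all_order all_algebra.
From mathcomp Require Import all_classical all_reals all_analysis.
From mathcomp Require Import zify.

Set Implicit Arguments.
Unset Strict Implicit.
Unset Printing Implicit Defensive.

Import Order.TTheory GRing.Theory Num.Theory.
Import numFieldNormedType.Exports.

Local Open Scope classical_set_scope.
Local Open Scope ring_scope.

(* Index conventions: an ordinal [i : 'I_n] stands for the one-based index
   [i.+1] of {1, ..., n}; the functions below that depend on the numerical
   value of an index ([tau], [alpha]) take the one-based index. *)

Section Linear_algebra.
Context {R : realType} {n : nat}.

Definition dotv (u v : 'cV[R]_n) : R := \sum_i u i 0 * v i 0.

Definition norm2 (u : 'cV[R]_n) : R := Num.sqrt (dotv u u).

(* The norm [`|M|] of the library is the sup norm. *)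
Definition frobenius (M : 'M[R]_n) : R := Num.sqrt (\sum_i \sum_j M i j ^+ 2).

Definition sym_posdef (M : 'M[R]_n) : Prop :=
  M^T = M /\ forall u : 'cV[R]_n, u != 0 -> 0 < dotv (M *m u) u.

End Linear_algebra.

Section Probability.
Context {R : realType} {d : measure_display} {T : measurableType d}.
Variable P : probability T R.

Definition mutually_independent (I : finType) (X : I -> {RV P >-> R}) : Prop :=
  forall (J : {set I}) (A : I -> set R), (forall i, measurable (A i)) ->
    P (\bigcap_(i in [set` J]) (X i @^-1` A i)) =
    (\prod_(i in J) fine (P (X i @^-1` A i)))%:E.

Definition uniform_law (a b : R) (ab : a < b) (X : {RV P >-> R}) : Prop :=
  forall A : set R, measurable A -> distribution P X A = uniform_prob ab A.

Definition matrix_random_field (n : nat)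
    (C : 'rV[R]_3 -> T -> 'M[R]_n) : Prop :=
  forall x i j, measurable_fun [set: T] (fun t => C x t i j).

Definition second_order (n : nat) (C : 'rV[R]_3 -> T -> 'M[R]_n) : Prop :=
  forall x, ('E_P[fun t => (frobenius (C x t) ^+ 2)%R] < +oo)%E.

End Probability.

Lemma twopi_gt0 (R : realType) : 0 < 2 * pi :> R.
Proof. by rewrite mulr_gt0 ?pi_gt0. Qed.

Section Isoprobabilistic_transform.
Context {R : realType}.
Local Notation mu := (@lebesgue_measure R).

Definition normal_cdf (b : R) : R := fine (normal_prob 0 1 `]-oo, b]).

Definition Gamma (al : R) : R :=
  \int[mu]_(t in `[0, +oo[) (t `^ (al - 1) * expR (- t)).

Definition gamma_cdf (al ga : R) : R :=
  (Gamma al)^-1 * \int[mu]_(t in `[0, ga]) (t `^ (al - 1) * expR (- t)).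

(* [gamma_cdf al] is a bijection from [0, +oo[ onto [0, 1[ for [al > 0], and
   [normal_cdf b] lies in ]0, 1[. *)
Definition h (b al : R) : R :=
  'pinv_(fun=> 0) `[0, +oo[ (gamma_cdf al) (normal_cdf b).

End Isoprobabilistic_transform.

(* {1, ..., nus}^3; the reduced index set {1, ..., nus/2}^3 is [idx nus./2]. *)
Notation idx nus := {ffun 'I_3 -> 'I_nus}.

Section Spectral_discretization.
Context {R : realType} (nus : nat).

Definition tau (k : nat) : R := -1 + (k%:R - 2^-1) * (2 / nus%:R).

Variable chi : 'rV[R]_3 -> R.

(* The multi-index is taken with values in [nat] (still zero-based), so that
   the same formula serves for the full and for the reduced index sets. *)
Definition chiD (b : 'I_3 -> nat) : R :=
  (2 / nus%:R) ^+ 3 * chi (\row_j tau (b j).+1).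

(* Zero-based form of [min(b, nus + 1 - b)]. *)
Lemma fold_subproof (nus_even : ~~ odd nus) (i : 'I_nus) :
  (minn i (rev_ord i) < nus./2)%N.
Proof.
by case: i => i /=; move: nus_even; lia.
Qed.

Definition fold_ord (nus_even : ~~ odd nus) (i : 'I_nus) : 'I_(nus./2) :=
  Ordinal (fold_subproof nus_even i).

Definition fold_idx (nus_even : ~~ odd nus) (b : idx nus) : idx nus./2 :=
  [ffun j => fold_ord nus_even (b j)].

Variable q : idx nus./2 -> 'M[R]_(3, nus./2) -> R -> R.
Variable delta_s : R.

Definition a_hat (y : 'M[R]_(3, nus./2)) (b : idx nus./2) : R :=
  Num.sqrt (chiD (fun j => b j)) * q b y delta_s.

Variable nus_even : ~~ odd nus.

Definition a_full (y : 'M[R]_(3, nus./2)) (b : idx nus) : R :=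
  a_hat y (fold_idx nus_even b).

Definition chiT (y : 'M[R]_(3, nus./2)) (b : idx nus) : R :=
  a_full y b ^+ 2 * (\sum_(b' : idx nus) a_full y b' ^+ 2)^-1.

(* [S = (w, y)] *)
Definition germ (x : 'rV[R]_3) (S : 'rV[R]_3 * 'M[R]_(3, nus./2))
    (z phi : idx nus -> R) : R :=
  \sum_(b : idx nus) Num.sqrt (2 * chiT S.2 b) * z b *
    cos (phi b + \sum_(j < 3) pi / S.1 0 j * tau (b j).+1 * x 0 j).

End Spectral_discretization.

Section Parameter_sets.
Context {R : realType}.

Definition Cy {n : nat} : set 'M[R]_(3, n) :=
  [set y | forall i j, 0 <= y i j <= 1].

Definition y_mean {n : nat} : 'M[R]_(3, n) := const_mx 2^-1.

Definition Cw (wmin wmax : 'rV[R]_3) : set 'rV[R]_3 :=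
  [set w | forall j, wmin 0 j <= w 0 j <= wmax 0 j].

Definition CS {n : nat} (wmin wmax : 'rV[R]_3) :
    set ('rV[R]_3 * 'M[R]_(3, n)) :=
  Cw wmin wmax `*` Cy.

End Parameter_sets.

Section Random_field.
Context {R : realType}.

Definition sigma (delta_c : R) : R := delta_c / Num.sqrt 7.

Definition alpha (delta_c : R) (m : nat) : R :=
  1 / (2 * sigma delta_c ^+ 2) + (1 - m%:R) / 2.

(* [G m n] is the value of the germ of index (m, n); only its values with
   [m <= n] are used. *)
Definition Lmat (delta_c : R) (G : 'I_6 -> 'I_6 -> R) : 'M[R]_6 :=
  \matrix_(m, n)
    if (m < n)%N then sigma delta_c * G m n
    else if m == n then
      sigma delta_c * Num.sqrt (2 * h (G m m) (alpha delta_c m.+1))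
    else 0.

Definition Cmat (delta_c : R) (G : 'I_6 -> 'I_6 -> R) : 'M[R]_6 :=
  (Lmat delta_c G)^T *m Lmat delta_c G.

End Random_field.

Section Random_germs.
Context {R : realType} {d : measure_display} {T : measurableType d}.
Variables (P : probability T R) (nus : nat).
Variables Z Phi : 'I_6 -> 'I_6 -> idx nus -> {RV P >-> R}.

Definition upper_pair : finType := {p : 'I_6 * 'I_6 | (p.1 <= p.2)%N}.

(* The scalar components of the 21 vectors [(Z m n, Phi m n)], [m <= n]: their
   mutual independence expresses both that the 21 vectors are independent and
   that the [2 * nus ^ 3] components of each of them are. *)
Definition germ_family (i : upper_pair * (idx nus + idx nus)) : {RV P >-> R} :=
  let: (p, k) := i in
  match k with
  | inl b => Z (val p).1 (val p).2 b
  | inr b => Phi (val p).1 (val p).2 b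
  end.

Variable chi : 'rV[R]_3 -> R.
Variable q : idx nus./2 -> 'M[R]_(3, nus./2) -> R -> R.
Variables (delta_s : R) (nus_even : ~~ odd nus).

Definition Ggerm (m n : 'I_6) (x : 'rV[R]_3)
    (S : 'rV[R]_3 * 'M[R]_(3, nus./2)) (t : T) : R :=
  germ chi q delta_s nus_even x S
    (fun b => Z m n b t) (fun b => Phi m n b t).

Definition Cfield (delta_c : R) (S : 'rV[R]_3 * 'M[R]_(3, nus./2))
    (x : 'rV[R]_3) (t : T) : 'M[R]_6 :=
  Cmat delta_c (fun m n => Ggerm m n x S t).

End Random_germs.

(* Main.v *)
Require Import Defs.
From HB Require Import structures.
From mathcomp Require Import all_boot all_order all_algebra.
From mathcomp Require Import all_classical all_reals all_analysis.
From mathcomp Require Import measurable_realfun ring lra.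

Set Implicit Arguments.
Unset Strict Implicit.
Unset Printing Implicit Defensive.

Import Order.TTheory GRing.Theory Num.Theory.
Import numFieldNormedType.Exports.

Local Open Scope classical_set_scope.
Local Open Scope ring_scope.

(** The bound [GammaC] can be written down explicitly, as an affine function of
    the sum of the squared amplitudes [Z m n b ^+ 2], and it bounds the field
    pointwise in [t].

    Since [C = L^T *m L], the Frobenius norm of [C] is at most the sum of the
    squared entries of [L] ([frobenius_gram_le]). Above the diagonal these are
    squared germs up to [sigma ^+ 2]. A germ is a combination of the amplitudes
    with coefficients of absolute value at most [Num.sqrt 2], because cosines
    and normalized spectral weights are at most 1; this is where [x] and [S]
    disappear ([sqr_germ_le]).

    On the diagonal they are values of [h] up to [2 * sigma ^+ 2], and [h] grows
    at most quadratically ([h_le]). Indeed [h b al <= g] amounts to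
    [1 - gamma_cdf al g <= 1 - normal_cdf b]. The normal tail beyond [b] is at
    least a multiple of [expR (- b ^+ 2)], seen on a unit interval starting at
    [b], and the gamma tail beyond [g] is at most a multiple of
    [expR (- g / 2)], so [g = 2 * b ^+ 2 + A] suffices for a large constant [A].
    The same comparison gives, by the intermediate value theorem, that
    [normal_cdf b] is a value of [gamma_cdf al], hence that [h b al] is a true
    quantile; it is positive, which makes [L] invertible and [C] positive
    definite, and nondecreasing in [b], which makes the field measurable.

    It remains to see that the sum of the [Z m n b ^+ 2] has a fourth moment. By
    convexity of the fourth power each term may be treated separately, and
    [Z ^+ 8 = (- ln Psi) ^+ 4] is dominated by a multiple of [Psi `^ (- 2^-1)],
    which is integrable ([finite_moment4_rayleigh]). Second-order integrability
    of the field follows from the second moment of [GammaC], and the bound on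
    the bilinear form is the Cauchy-Schwarz inequality ([dotv_mulmx_le]). *)

(** * Linear algebra *)

Section Finite_sums.
Context {R : rcfType} {I : finType}.

(** Lagrange's identity: the right side minus the left side is half the sum of
    the squares [(a i * b j - a j * b i) ^+ 2]. *)
Lemma cauchy_schwarz_sum (a b : I -> R) :
  (\sum_i a i * b i) ^+ 2 <= (\sum_i a i ^+ 2) * (\sum_i b i ^+ 2).
Proof.
have sqr_ge0 : 0 <= \sum_i \sum_j (a i * b j - a j * b i) ^+ 2.
  by apply: sumr_ge0 => i _; apply: sumr_ge0 => j _; exact: sqr_ge0.
have lagrange : \sum_i \sum_j (a i * b j - a j * b i) ^+ 2 =
    (\sum_i a i ^+ 2) * (\sum_i b i ^+ 2) * 2 - (\sum_i a i * b i) ^+ 2 * 2.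
  transitivity (\sum_i \sum_j (a i ^+ 2 * b j ^+ 2 +
      (b i ^+ 2 * a j ^+ 2 - (a i * b i) * (a j * b j) * 2))).
    by apply: eq_bigr => i _; apply: eq_bigr => j _; ring.
  under eq_bigr do rewrite big_split/= sumrB -!mulr_sumr -mulr_suml -mulr_sumr.
  rewrite big_split/= sumrB -!mulr_suml; ring.
by rewrite lagrange in sqr_ge0; lra.
Qed.

Lemma sqr_sum_le (a : I -> R) :
  (\sum_i a i) ^+ 2 <= #|I|%:R * \sum_i a i ^+ 2.
Proof.
have := cauchy_schwarz_sum (fun=> 1) a.
under eq_bigr do rewrite mul1r.
by under [X in _ <= X * _]eq_bigr do rewrite expr1n; rewrite sumr_const.
Qed.

End Finite_sums.

Section Frobenius_norm.
Context {R : realType} {n : nat}.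

Lemma sumsq_ge0 (M : 'M[R]_n) : 0 <= \sum_i \sum_j M i j ^+ 2.
Proof. by apply: sumr_ge0 => i _; apply: sumr_ge0 => j _; exact: sqr_ge0. Qed.

Lemma frobenius_ge0 (M : 'M[R]_n) : 0 <= frobenius M.
Proof. exact: sqrtr_ge0. Qed.

Lemma dotv_ge0 (u : 'cV[R]_n) : 0 <= dotv u u.
Proof. by apply: sumr_ge0 => i _; rewrite -expr2 sqr_ge0. Qed.

(** Submultiplicativity of the Frobenius norm: each entry of [L^T *m L] is the
    scalar product of two columns of [L]. *)
Lemma frobenius_gram_le (L : 'M[R]_n) :
  frobenius (L^T *m L) <= \sum_i \sum_j L i j ^+ 2.
Proof.
have L0 := sumsq_ge0 L.
rewrite -(ger0_norm L0) -sqrtr_sqr ler_wsqrtr// [leRHS]expr2.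
rewrite [in leRHS]exchange_big/= mulr_suml; apply: ler_sum => i _.
rewrite mulr_sumr; apply: ler_sum => j _.
rewrite mxE; under [X in X ^+ 2]eq_bigr do rewrite mxE.
exact: cauchy_schwarz_sum.
Qed.

Lemma dotv_mulmx_le (M : 'M[R]_n) (u v : 'cV[R]_n) :
  `|dotv (M *m u) v| <= frobenius M * norm2 u * norm2 v.
Proof.
have -> : dotv (M *m u) v =
    \sum_(p : 'I_n * 'I_n) M p.1 p.2 * (u p.2 0 * v p.1 0).
  rewrite /dotv -(pair_bigA _ (fun i j => M i j * (u j 0 * v i 0)))/=.
  apply: eq_bigr => i _; rewrite mxE mulr_suml.
  by apply: eq_bigr => j _; ring.
rewrite -mulrA /frobenius /norm2 -sqrtrM ?dotv_ge0// -sqrtrM ?sumsq_ge0//.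
rewrite -sqrtr_sqr ler_wsqrtr//.
apply: (le_trans (cauchy_schwarz_sum _ _)).
rewrite -(pair_bigA _ (fun i j => M i j ^+ 2))/=.
rewrite -(pair_bigA _ (fun i j => (u j 0 * v i 0) ^+ 2))/=.
apply: ler_wpM2l; first exact: sumsq_ge0.
rewrite /dotv mulrC mulr_suml le_eqVlt; apply/orP; left; apply/eqP.
apply: eq_bigr => i _.
by rewrite mulr_sumr; apply: eq_bigr => j _; ring.
Qed.

(** The Gram matrix of an invertible matrix is positive definite, and the
    determinant of a triangular matrix is the product of its diagonal. *)
Lemma sym_posdef_gram (L : 'M[R]_n) :
  is_trig_mx L^T -> (forall i, 0 < L i i) -> sym_posdef (L^T *m L).
Proof.
move=> trigL L0; split; first by rewrite trmx_mul trmxK.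
move=> u u0.
have unitL : L \in unitmx.
  rewrite unitmxE -det_tr det_trig// unitfE; apply/prodf_neq0 => i _.
  by rewrite mxE gt_eqF.
have Lu0 : L *m u != 0.
  by apply: contra u0 => /eqP Lu0; rewrite -(mulKmx unitL u) Lu0 mulmx0 eqxx.
have -> : dotv (L^T *m L *m u) u = dotv (L *m u) (L *m u).
  transitivity ((u^T *m (L^T *m L *m u)) 0 0).
    rewrite [RHS]mxE /dotv; apply: eq_bigr => i _.
    by rewrite [X in _ = X * _]mxE mulrC.
  rewrite -!mulmxA mulmxA -trmx_mul mxE /dotv; apply: eq_bigr => i _.
  by rewrite [X in X * _]mxE.
rewrite lt_def dotv_ge0 andbT; apply: contra Lu0.
rewrite psumr_eq0; last by move=> i _; rewrite -expr2 sqr_ge0.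
move=> /allP Lu0; apply/eqP/matrixP => i j.
have := Lu0 i (mem_index_enum i).
by rewrite mulf_eq0 orbb (ord1 j) mxE [in RHS]mxE => /eqP.
Qed.

End Frobenius_norm.

(** * Tails of the standard normal law *)

Section Normal_tails.
Context {R : realType}.
Local Notation mu := (@lebesgue_measure R).
Implicit Types a b : R.

(** A lower bound for the normal mass of any interval of length 1 adjacent to
    [b]: it is [normal_peak 1] times [expR (- (`|b| + 1) ^+ 2 / 2)], up to the
    elementary inequality [(`|b| + 1) ^+ 2 <= 2 * (b ^+ 2 + 1)]. *)
Definition normal_mass_lb b : R := normal_peak 1 * expR (- (b ^+ 2 + 1)).

Lemma normal_mass_lb_gt0 b : 0 < normal_mass_lb b.
Proof. by rewrite mulr_gt0 ?expR_gt0 ?normal_peak_gt0 ?oner_eq0. Qed.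

Lemma normal_pdf_ge_mass b x : `|x| <= `|b| + 1 ->
  normal_mass_lb b <= normal_pdf 0 1 x.
Proof.
move=> xb; rewrite normal_pdfE ?oner_eq0//.
rewrite /normal_mass_lb ler_wpM2l ?normal_peak_ge0// /normal_fun ler_expR.
have : x ^+ 2 <= (`|b| + 1) ^+ 2.
  by rewrite -(real_normK (num_real x)) lerXn2r// nnegrE addr_ge0.
have : (`|b| + 1) ^+ 2 <= 2 * (b ^+ 2 + 1).
  rewrite -(real_normK (num_real b)) -subr_ge0.
  suff -> : 2 * (`|b| ^+ 2 + 1) - (`|b| + 1) ^+ 2 = (`|b| - 1) ^+ 2.
    by rewrite sqr_ge0.
  by ring.
rewrite subr0 expr1n; lra.
Qed.

Lemma normal_prob_unit_itv a b :
  (forall x, a < x <= a + 1 -> `|x| <= `|b| + 1) ->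
  ((normal_mass_lb b)%:E <= normal_prob 0 1 `]a, (a + 1)%R]%classic)%E.
Proof.
move=> ab.
have -> : (normal_mass_lb b)%:E =
    (\int[mu]_(x in `]a, (a + 1)%R]) (normal_mass_lb b)%:E)%E.
  rewrite integral_cst//= lebesgue_measure_itv/= lte_fin ltrDl ltr01.
  by rewrite -EFinB addrAC subrr add0r mule1.
apply: ge0_le_integral => //=.
- by move=> x _; rewrite lee_fin ltW ?normal_mass_lb_gt0.
- apply/measurable_EFinP; apply: measurable_funTS.
  exact: measurable_normal_pdf.
- move=> x; rewrite in_itv/= => /ab xb.
  by rewrite lee_fin normal_pdf_ge_mass.
Qed.

Lemma normal_cdfE b : (normal_cdf b)%:E = normal_prob 0 1 `]-oo, b]%classic.
Proof. by rewrite fineK// fin_num_measure. Qed.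

Lemma normal_cdf_nondecreasing : {homo @normal_cdf R : a b / a <= b}.
Proof.
move=> a b ab; rewrite -lee_fin !normal_cdfE le_measure ?inE//.
by apply: subset_itvl; rewrite bnd_simp.
Qed.

Lemma normal_cdf_ge b : normal_mass_lb b <= normal_cdf b.
Proof.
rewrite -lee_fin normal_cdfE.
apply: (@le_trans _ _ (normal_prob 0 1 `](b - 1)%R, (b - 1 + 1)%R]%classic)).
  apply: normal_prob_unit_itv => x /andP[x1 x2].
  have := lexx `|b|; rewrite ler_norml => /andP[b1 b2].
  by rewrite ler_norml; apply/andP; split; lra.
rewrite subrK; apply: le_measure; rewrite ?inE//.
by move=> x /=; rewrite !in_itv/= => /andP[].
Qed.

Lemma normal_cdf_le b : normal_cdf b <= 1 - normal_mass_lb b.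
Proof.
rewrite lerBrDr addrC -lerBrDr.
have -> : 1 - normal_cdf b = fine (normal_prob 0 1 `]b, +oo[%classic).
  apply: EFin_inj; rewrite EFinB normal_cdfE fineK ?fin_num_measure//.
  by rewrite -setCitvl [RHS]probability_setC.
rewrite -lee_fin fineK ?fin_num_measure//.
apply: (@le_trans _ _ (normal_prob 0 1 `]b, (b + 1)%R]%classic)).
  apply: normal_prob_unit_itv => x /andP[x1 x2].
  have := lexx `|b|; rewrite ler_norml => /andP[b1 b2].
  by rewrite ler_norml; apply/andP; split; lra.
apply: le_measure; rewrite ?inE//.
by move=> x /=; rewrite !in_itv/= andbT => /andP[].
Qed.

End Normal_tails.

(** * The gamma law and its quantiles *)

Section Exponential_tail.
Context {R : realType}.
Local Notation mu := (@lebesgue_measure R).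

Let ehalf (t : R) : R := expR (- 2^-1 * t).

Let ehalf_continuous : continuous (fun t : R^o => expR (- 2^-1 * t)).
Proof.
move=> t; apply: continuous_comp; last exact: continuous_expR.
by apply: continuousM => //; exact: cst_continuous.
Qed.

Lemma integral_expR_half (g : R) :
  (\int[mu]_(t in `[g, +oo[) (expR (- 2^-1 * t))%:E =
   (2 * expR (- 2^-1 * g))%:E)%E.
Proof.
rewrite (@ge0_continuous_FTC2y _ _ (fun t => - 2 * ehalf t) _ 0).
- by rewrite -EFinB /ehalf; congr EFin; ring.
- by move=> x _; exact: expR_ge0.
- exact/continuous_subspaceT/ehalf_continuous.
- rewrite -(mulr0 (- 2)); apply: cvgMl_tmp.
  have -> : ehalf = (fun z => expR (- z)) \o (fun z => 2^-1 * z).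
    by apply/funext => x; rewrite /ehalf /= mulNr.
  apply: (@cvg_comp _ _ _ _ _ _ (pinfty_nbhs R)); last exact: cvgr_expR.
  exact: gt0_cvgMry.
- by move=> x _; apply: ex_derive.
- by apply: cvgMl_tmp; apply/cvg_at_right_filter; exact: ehalf_continuous.
- move=> x _; rewrite derive1E derive_val.
  by rewrite /GRing.scale/=; field.
Qed.

Lemma integrable_expR_half (g : R) :
  mu.-integrable `[g, +oo[ (EFin \o (fun t => expR (- 2^-1 * t))).
Proof.
apply/integrableP; split.
  apply/measurable_EFinP; apply: measurable_funTS.
  by apply: measurableT_comp => //; exact: measurable_funM.
under eq_integral do rewrite /= ger0_norm ?expR_ge0//.
by rewrite integral_expR_half ltry.
Qed.

End Exponential_tail.

Section Gamma_law.
Context {R : realType}.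
Local Notation mu := (@lebesgue_measure R).
Variable al : R.
Hypothesis al_gt1 : 1 < al.

Definition gamma_density (t : R) : R := t `^ (al - 1) * expR (- t).

Let al1_gt0 : 0 < al - 1. Proof. by rewrite subr_gt0. Qed.

Lemma gamma_density_ge0 t : 0 <= gamma_density t.
Proof. by rewrite mulr_ge0 ?powR_ge0 ?expR_ge0. Qed.

Let measurable_gamma_density D : measurable_fun D gamma_density.
Proof.
apply: measurable_funTS; apply: measurable_funM.
  exact: measurable_powR.
by apply: measurableT_comp.
Qed.

Let K : R := (2 * (al - 1)) `^ (al - 1).

(** With [c := 2 * (al - 1)], the inequality [t / c <= expR (t / c)] raised to
    the power [al - 1] reads [(t / c) `^ (al - 1) <= expR (t / 2)]. *)
Lemma gamma_density_le t : 0 <= t -> gamma_density t <= K * expR (- 2^-1 * t).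
Proof.
move=> t0; set c := 2 * (al - 1).
have c0 : 0 < c by rewrite mulr_gt0.
have -> : expR (- 2^-1 * t) = expR (t / 2) * expR (- t).
  by rewrite -expRD; congr expR; field.
rewrite mulrA ler_wpM2r ?expR_ge0//.
have {1}-> : t = c * (t / c) by rewrite mulrC divfK ?gt_eqF.
have tc0 : 0 <= t / c by rewrite divr_ge0// ltW.
rewrite powRM ?(ltW c0)// ler_wpM2l ?powR_ge0//.
have -> : expR (t / 2) = expR (t / c) `^ (al - 1).
  by rewrite -expRM; congr expR; rewrite /c; field; rewrite gt_eqF.
apply: ge0_ler_powR; rewrite ?nnegrE ?expR_ge0//; first exact: ltW.
by apply: le_trans (expR_ge1Dx _); rewrite lerDr.
Qed.

Let K_ge0 : 0 <= K. Proof. exact: powR_ge0. Qed.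

Let integrable_bound (g : R) :
  mu.-integrable `[g, +oo[ (EFin \o (fun t => K * expR (- 2^-1 * t))).
Proof.
rewrite (_ : _ \o _ = fun t => (K%:E * (expR (- 2^-1 * t))%:E)%E)//.
by apply: integrableZl => //; exact: integrable_expR_half.
Qed.

Lemma integrable_gamma_density :
  mu.-integrable `[0, +oo[ (EFin \o gamma_density).
Proof.
apply: (le_integrable _ _ _ (integrable_bound 0)) => //.
- apply/measurable_EFinP; exact: measurable_gamma_density.
- move=> t; rewrite /= in_itv/= andbT => t0.
  rewrite lee_fin !ger0_norm ?gamma_density_ge0 ?mulr_ge0 ?expR_ge0//.
  exact: gamma_density_le.
Qed.

Let integrable_sub (i : interval R) : [set` i] `<=` `[0, +oo[%classic ->
  mu.-integrable [set` i] (EFin \o gamma_density).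
Proof.
move=> i0; apply: (@integrableS _ _ _ mu `[0, +oo[%classic) => //.
exact: integrable_gamma_density.
Qed.

Lemma gamma_tailE g : 0 <= g ->
  Gamma al - \int[mu]_(t in `[0, g]) gamma_density t =
  \int[mu]_(t in `]g, +oo[) gamma_density t.
Proof.
by move=> g0; rewrite Rintegral_itvB//; exact: integrable_gamma_density.
Qed.

Lemma gamma_tail_le g : 0 <= g ->
  Gamma al - \int[mu]_(t in `[0, g]) gamma_density t <=
  K * 2 * expR (- 2^-1 * g).
Proof.
move=> g0; rewrite gamma_tailE//.
have itg : [set` `]g, +oo[] `<=` `[0, +oo[%classic.
  by move=> t /=; rewrite !in_itv/= !andbT => /ltW; exact: le_trans.
rewrite Rintegral_itv_obnd_cbnd; last exact: integrable_sub.
have -> : K * 2 * expR (- 2^-1 * g) =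
    \int[mu]_(t in `[g, +oo[) (K * expR (- 2^-1 * t)).
  rewrite RintegralZl//; last exact: integrable_expR_half.
  by rewrite /Rintegral integral_expR_half mulrA.
apply: le_Rintegral => //.
- by apply: integrable_sub => t /=; rewrite !in_itv/= !andbT; exact: le_trans.
- move=> t /=; rewrite in_itv/= andbT => gt.
  by apply: gamma_density_le; exact: le_trans gt.
Qed.

Lemma Gamma_gt0 : 0 < Gamma al.
Proof.
have sub12 : [set` `[1, 2]] `<=` (`[0, +oo[%classic : set R).
  by move=> t /=; rewrite !in_itv/= => /andP[t1 _]; lra.
have lb (t : R) : `[1, 2]%classic t -> expR (- 2) <= gamma_density t.
  rewrite /= in_itv/= => /andP[t1 t2].
  rewrite -[leLHS]mul1r ler_pM ?expR_ge0 ?ler_expR ?lerN2//.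
  by rewrite -[leLHS](powRr0 t) ler_powR// ltW.
apply: (@lt_le_trans _ _ (\int[mu]_(t in `[1, 2]) expR (- 2))).
  rewrite Rintegral_cst//= lebesgue_measure_itv/= lte_fin ltr1n/=.
  by rewrite mulr_gt0 ?expR_gt0//; lra.
apply: (@le_trans _ _ (\int[mu]_(t in `[1, 2]) gamma_density t)).
  apply: le_Rintegral => //; last exact: integrable_sub.
  apply: le_integrable (integrable_sub sub12) => //.
    by apply/measurable_EFinP; exact: measurable_cst.
  move=> t t12; rewrite /= lee_fin !ger0_norm ?expR_ge0 ?gamma_density_ge0//.
  exact: lb.
apply: fine_le.
- exact/integrable_fin_num/integrable_sub.
- exact/integrable_fin_num/integrable_gamma_density.
- apply: ge0_subset_integral => //.
    by apply/measurable_EFinP; exact: measurable_gamma_density.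
  by move=> t _; rewrite lee_fin gamma_density_ge0.
Qed.

Lemma gamma_cdf0 : gamma_cdf al 0 = 0.
Proof. by rewrite /gamma_cdf set_itv1 Rintegral_set1 mulr0. Qed.

Lemma gamma_cdf_nondecreasing a b : 0 <= a -> a <= b ->
  gamma_cdf al a <= gamma_cdf al b.
Proof.
move=> a0 ab; rewrite /gamma_cdf ler_wpM2l ?invr_ge0 ?(ltW Gamma_gt0)//.
have sub0 c : [set` `[0, c]] `<=` (`[0, +oo[%classic : set R).
  by move=> t /=; rewrite !in_itv/= => /andP[-> _].
apply: fine_le.
- exact/integrable_fin_num/integrable_sub.
- exact/integrable_fin_num/integrable_sub.
- apply: ge0_subset_integral => //.
    by apply/measurable_EFinP; exact: measurable_gamma_density.
    by move=> t _; rewrite lee_fin gamma_density_ge0.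
  by apply: subset_itvl; rewrite bnd_simp.
Qed.

Lemma gamma_cdf_continuous g : 0 <= g ->
  {within `[0, g], continuous (gamma_cdf al)}.
Proof.
move=> g0 x; apply: cvgMl_tmp.
apply: (parameterized_integral_continuous g0) x.
by apply: integrable_sub => t /=; rewrite !in_itv/= => /andP[-> _].
Qed.

Lemma gamma_cdf_ge : exists2 C : R, 0 < C &
  forall g, 0 <= g -> 1 - C * expR (- 2^-1 * g) <= gamma_cdf al g.
Proof.
have G0 := Gamma_gt0.
have K0 : 0 < K by apply: powR_gt0; rewrite mulr_gt0.
exists (K * 2 / Gamma al) => [|g g0]; first by rewrite divr_gt0// mulr_gt0.
have := gamma_tail_le g0.
rewrite lerBlDl -lerBlDr -(ler_pM2l (_ : 0 < (Gamma al)^-1)) ?invr_gt0//.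
by rewrite mulrBr mulVf ?gt_eqF// mulrA [in _ * (_ * 2)]mulrC.
Qed.

End Gamma_law.

Section Isoprobabilistic_bounds.
Context {R : realType}.
Variable al : R.
Hypothesis al_gt1 : 1 < al.
Implicit Types a b : R.

(** The gamma law has a tail of order [expR (- g / 2)] at most and the normal
    law one of order [expR (- b ^+ 2)] at least, so the gamma law has less mass
    beyond [2 * b ^+ 2 + A] than the normal law beyond [b]. *)
Lemma normal_cdf_lt_gamma_cdf : exists2 A : R, 0 <= A &
  forall b, normal_cdf b < gamma_cdf al (2 * b ^+ 2 + A).
Proof.
have [C C0 HC] := gamma_cdf_ge al_gt1.
have p0 : 0 < normal_peak (1 : R) by rewrite normal_peak_gt0 ?oner_eq0.
(* [D < expR D], that is [C * expR (- D) < normal_peak 1], leaves room for the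
   constants of both tails. *)
pose D := C / normal_peak 1.
have D0 : 0 <= D by rewrite divr_ge0 ?ltW.
exists (2 * (1 + D)); first by lra.
move=> b; have g0 : 0 <= 2 * b ^+ 2 + 2 * (1 + D).
  by have := sqr_ge0 b; lra.
apply: (le_lt_trans (normal_cdf_le b)); apply: lt_le_trans (HC _ g0).
rewrite ltrD2l ltrN2 /normal_mass_lb.
have -> : - 2^-1 * (2 * b ^+ 2 + 2 * (1 + D)) = - (b ^+ 2 + 1) - D by field.
rewrite expRD mulrCA [ltRHS]mulrC ltr_pM2l ?expR_gt0//.
rewrite expRN ltr_pdivrMr ?expR_gt0// mulrC -ltr_pdivrMr// -/D.
by apply: lt_le_trans (expR_ge1Dx _); rewrite ltrDr.
Qed.

Lemma normal_cdf_in_image b : (gamma_cdf al @` `[0, +oo[) (normal_cdf b).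
Proof.
have [A A0 HA] := normal_cdf_lt_gamma_cdf.
have g0 : 0 <= 2 * b ^+ 2 + A by have := sqr_ge0 b; lra.
have F0 : 0 <= normal_cdf b.
  exact: le_trans (ltW (normal_mass_lb_gt0 b)) (normal_cdf_ge b).
have [|g gI <-] := @IVT _ (gamma_cdf al) 0 _ (normal_cdf b) g0
  (gamma_cdf_continuous al_gt1 g0).
  rewrite gamma_cdf0 minEle maxEle.
  by rewrite (le_trans F0 (ltW (HA b))) F0 (ltW (HA b)).
by exists g => //=; move: gI; rewrite !in_itv/= => /andP[->].
Qed.

Lemma h_ge0 b : 0 <= h b al.
Proof.
have /(_ (h b al)) := @surjpinv_image_sub _ _ (fun=> 0) `[0, +oo[%classic
  (gamma_cdf al @` `[0, +oo[%classic) _ (fun _ => id).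
rewrite /= in_itv/= andbT; apply.
by exists (normal_cdf b) => //; exact: normal_cdf_in_image.
Qed.

Lemma gamma_cdf_h b : gamma_cdf al (h b al) = normal_cdf b.
Proof. by rewrite /h pinvK// inE; exact: normal_cdf_in_image. Qed.

Lemma h_gt0 b : 0 < h b al.
Proof.
rewrite lt_def h_ge0 andbT; apply/eqP => h0.
have := gamma_cdf_h b; rewrite h0 gamma_cdf0 => F0.
have := lt_le_trans (normal_mass_lb_gt0 b) (normal_cdf_ge b).
by rewrite -F0 ltxx.
Qed.

Lemma h_le : exists2 A : R, 0 <= A & forall b, h b al <= 2 * b ^+ 2 + A.
Proof.
have [A A0 HA] := normal_cdf_lt_gamma_cdf; exists A => // b.
rewrite leNgt; apply/negP => /ltW hA.
have g0 : 0 <= 2 * b ^+ 2 + A by have := sqr_ge0 b; lra.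
have := gamma_cdf_nondecreasing al_gt1 g0 hA.
by rewrite gamma_cdf_h leNgt HA.
Qed.

(** Only the value of [normal_cdf b] enters [h b al], so weak monotonicity of
    both distribution functions is enough. *)
Lemma h_nondecreasing : {homo (h (R := R))^~ al : a b / a <= b}.
Proof.
move=> a b ab; rewrite leNgt; apply/negP => hba.
have := gamma_cdf_nondecreasing al_gt1 (h_ge0 b) (ltW hba).
rewrite !gamma_cdf_h => Fba.
have Fab : normal_cdf a = normal_cdf b.
  by apply/eqP; rewrite eq_le Fba normal_cdf_nondecreasing.
by move: hba; rewrite /h Fab ltxx.
Qed.

Lemma measurable_h : measurable_fun [set: R] ((h (R := R))^~ al).
Proof. by apply: nondecreasing_measurable => //; exact: h_nondecreasing. Qed.

End Isoprobabilistic_bounds.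

(** * Moments of the amplitudes *)

Section Logarithm_moment.
Context {R : realType}.
Local Notation mu := (@lebesgue_measure R).

(** The term of degree 4 of the exponential series bounds [s ^+ 4] by a multiple
    of [expR (s / 2)], here at [s = - ln u]. *)
Lemma ln4_le : exists2 c : R, 0 <= c &
  forall u, 0 < u <= 1 -> (- ln u) ^+ 4 <= c * u `^ (- 2^-1).
Proof.
exists (2 ^+ 4 * 4`!%:R); first by rewrite mulr_ge0 ?exprn_ge0.
move=> u /andP[u0 u1].
have s0 : 0 <= - ln u by rewrite oppr_ge0 ln_le0.
have := @expR_ge1Dxn R (- ln u / 2) 3; rewrite divr_ge0// => /(_ isT).
rewrite /powR gt_eqF// (_ : - ln u / 2 = - 2^-1 * ln u); last by field.
move=> ineq.
have -> : (- ln u) ^+ 4 = 2 ^+ 4 * 4`!%:R * ((- 2^-1 * ln u) ^+ 4 / 4`!%:R).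
  by field.
rewrite ler_wpM2l ?mulr_ge0 ?exprn_ge0//.
by apply: le_trans ineq; rewrite lerDr ler01.
Qed.

Lemma integral_rsqrt_le (a : R) : 0 < a < 1 ->
  (\int[mu]_(u in `[a, 1%R]) (u `^ (- 2^-1))%:E <= 2%:E)%E.
Proof.
move=> /andP[a0 a1].
pose F (u : R) : R := 2 * u `^ 2^-1.
have dF (u : R) : 0 < u -> is_derive u 1 F (u `^ (- 2^-1)).
  move=> u0; have := is_derive1_powR 2^-1 u0 => du.
  rewrite (_ : u `^ _ = 2 *: (2^-1 * u `^ (2^-1 - 1))); last first.
    by rewrite scalerA mulfV// scale1r; congr powR; field.
  exact: is_deriveZ.
have contF (u : R) : 0 < u -> {for u, continuous F}.
  move=> u0; apply: differentiable_continuous; apply/derivable1_diffP.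
  by have [] := dF _ u0.
rewrite (@continuous_FTC2 _ _ F)//.
- by rewrite /F powR1 -EFinB lee_fin mulr1 gerBl mulr_ge0// powR_ge0.
- apply: derivable_within_continuous => u; rewrite in_itv/= => /andP[au _].
  by apply: derivable_powR; rewrite in_itv/= andbT (lt_le_trans a0).
- split.
  + move=> u; rewrite in_itv/= => /andP[au _].
    by have [] := dF u (lt_trans a0 au).
  + by apply: cvg_at_right_filter; exact: contF.
  + by apply: cvg_at_left_filter; exact: contF.
- move=> u; rewrite in_itv/= => /andP[au _].
  by rewrite derive1E; have [_ ->] := dF u (lt_trans a0 au).
Qed.

(** The singularity at 0 is integrable: exhaust [`]0, 1]] by the intervals
    [`[n.+2%:R^-1, 1]]. *)
Lemma integral_rsqrt_lty :
  (\int[mu]_(u in `]0%R, 1%R]) (u `^ (- 2^-1))%:E < +oo)%E.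
Proof.
pose I n : set R := `[n.+2%:R^-1, 1]%classic.
have I01 : `]0, 1]%classic = \bigcup_n I n.
  apply/seteqP; split => u /=.
    rewrite in_itv/= => /andP[u0 u1].
    exists (Num.truncn u^-1) => //; rewrite /I /= in_itv/= u1 andbT.
    rewrite invf_ple ?posrE//.
    have := truncnS_gt u^-1; move=> /ltW/le_trans; apply.
    by rewrite ler_nat.
  move=> [n _]; rewrite /I /= !in_itv/= => /andP[nu ->]; rewrite andbT.
  by apply: lt_le_trans nu; rewrite invr_gt0.
have mf D : measurable_fun D (fun u : R => (u `^ (- 2^-1))%:E).
  by apply/measurable_EFinP; apply: measurable_funTS; exact: measurable_powR.
have cvgI := @ge0_nondecreasing_set_cvg_integral _ (measurableTypeR R) R I
  (fun u => (u `^ (- 2^-1))%:E) mu.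
apply: (@le_lt_trans _ _ 2%:E); last exact: ltry.
have ndI : nondecreasing_seq I.
  move=> m n mn; rewrite subsetEset; apply: subset_itvr; rewrite bnd_simp.
  by rewrite lef_pV2 ?posrE ?ltr0n// ler_nat.
have {}cvgI := cvgI ndI (fun=> measurable_itv _) (fun=> mf _)
  (fun _ _ _ => powR_ge0 _ _).
rewrite I01 -(cvg_lim _ cvgI)//.
apply: lime_le; first exact: cvgP cvgI.
apply: nearW => n; apply: integral_rsqrt_le.
by rewrite invr_gt0 ltr0n/= invf_lt1// ltr1n.
Qed.

End Logarithm_moment.

Section Fourth_moments.
Context {R : realType} {d : measure_display} {T : measurableType d}.
Variable P : probability T R.

Definition finite_moment4 (X : T -> R) : Prop :=
  measurable_fun [set: T] X /\
  P.-integrable [set: T] (fun t => (X t ^+ 4)%:E).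

Lemma integrable_of_lty (f : T -> R) : measurable_fun [set: T] f ->
  (forall t, 0 <= f t) -> (\int[P]_t (f t)%:E < +oo)%E ->
  P.-integrable [set: T] (fun t => (f t)%:E).
Proof.
move=> mf f0 intf; apply/integrableP; split; first exact/measurable_EFinP.
by under eq_integral do rewrite /= ger0_norm//.
Qed.

Lemma measurable_sqrtr (D : set R) : measurable_fun D (@Num.sqrt R).
Proof.
apply: measurable_funTS.
by apply: nondecreasing_measurable => // x y; exact: ler_wsqrtr.
Qed.

Lemma finite_moment4_cst (c : R) : finite_moment4 (fun=> c).
Proof.
split; first exact: measurable_cst.
exact: (finite_measure_integrable_cst P (c ^+ 4)).
Qed.

Lemma finite_moment4Z (c : R) (X : T -> R) : finite_moment4 X ->
  finite_moment4 (fun t => c * X t).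
Proof.
move=> [mX iX]; split; first exact: measurable_funM.
under eq_fun do rewrite exprMn EFinM.
exact: integrableZl.
Qed.

(** Convexity of the fourth power: [(x + y) ^+ 4 <= 8 * (x ^+ 4 + y ^+ 4)]. *)
Lemma finite_moment4D (X Y : T -> R) :
  finite_moment4 X -> finite_moment4 Y ->
  finite_moment4 (fun t => X t + Y t).
Proof.
move=> [mX iX] [mY iY]; have mXY := measurable_funD mX mY; split => //.
pose g t : \bar R := (8%:E * ((X t ^+ 4)%:E + (Y t ^+ 4)%:E))%E.
apply: (@le_integrable _ _ _ P setT measurableT _ g).
- by apply/measurable_EFinP; exact: measurable_funX.
- move=> t _; rewrite /g -EFinD -EFinM lee_fin.
  set x := X t; set y := Y t.
  have sq2 (a b : R) : (a + b) ^+ 2 <= 2 * (a ^+ 2 + b ^+ 2).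
    by have := sqr_ge0 (a - b); rewrite sqrrB sqrrD; lra.
  rewrite !ger0_norm ?exprn_even_ge0//; last first.
    by rewrite mulr_ge0// addr_ge0// exprn_even_ge0.
  have xy0 : 0 <= (x + y) ^+ 2 by exact: sqr_ge0.
  have h1 : (x + y) ^+ 4 <= (2 * (x ^+ 2 + y ^+ 2)) ^+ 2.
    rewrite (_ : 4 = 2 * 2)%N// exprM lerXn2r ?nnegrE// (le_trans xy0)//.
  have := sq2 (x ^+ 2) (y ^+ 2); rewrite -!exprM => h2.
  by apply: (le_trans h1); rewrite exprMn; lra.
- apply: integrableZl => //; exact: integrableD.
Qed.

Lemma finite_moment4_sum (I : Type) (r : seq I) (Q : pred I) (X : I -> T -> R) :
  (forall i, Q i -> finite_moment4 (X i)) ->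
  finite_moment4 (fun t => \sum_(i <- r | Q i) X i t).
Proof.
move=> HX; elim: r => [|i r IH].
  by under eq_fun do rewrite big_nil; exact: finite_moment4_cst.
under eq_fun do rewrite big_cons.
by case: (boolP (Q i)) => // Qi; apply: finite_moment4D => //; exact: HX.
Qed.

Lemma finite_moment4_expectation (X : T -> R) : finite_moment4 X ->
  ('E_P[fun t => (X t ^+ 4)%R] < +oo)%E /\
  ('E_P[fun t => (X t ^+ 2)%R] < +oo)%E.
Proof.
move=> [mX iX]; rewrite unlock.
have X4 : (\int[P]_t (X t ^+ 4)%:E < +oo)%E.
  by apply: integrable_lty.
split => //.
apply: (@le_lt_trans _ _ (\int[P]_t (1 + (X t ^+ 4)%:E))%E); last first.
  rewrite integralD//; last exact: (finite_measure_integrable_cst P 1).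
  by rewrite integral_cst//= probability_setT mule1 lte_add_pinfty// ltry.
apply: ge0_le_integral => //.
- by move=> t _; rewrite lee_fin sqr_ge0.
- by apply/measurable_EFinP; exact: measurable_funX.
- by apply/measurable_EFinP/measurable_funD => //; exact: measurable_funX.
- move=> t _; rewrite -EFinD lee_fin (_ : 4 = 2 * 2)%N// exprM.
  by have := sqr_ge0 (X t ^+ 2 - 1); rewrite sqrrB1; have := sqr_ge0 (X t); lra.
Qed.

(** [Z ^+ 8 = (- ln Psi) ^+ 4] almost surely, and on the unit interval
    [(- ln u) ^+ 4] is dominated by the integrable function [u `^ (- 2^-1)]. *)
Lemma finite_moment4_rayleigh (Z Psi : {RV P >-> R}) :
  uniform_law ltr01 Psi ->
  {ae P, forall t, Z t = Num.sqrt (- ln (Psi t))} ->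
  finite_moment4 (fun t => Z t ^+ 2).
Proof.
move=> Psi_law Z_def.
have mZ : measurable_fun [set: T] (fun t => Z t ^+ 2) by exact: measurable_funX.
split => //; apply: integrable_of_lty.
- exact: measurable_funX.
- by move=> t; rewrite exprn_even_ge0.
pose f (u : R) : R := (Num.sqrt (- ln u) ^+ 2) ^+ 4.
have f0 u : 0 <= f u by rewrite exprn_even_ge0.
have mf : measurable_fun [set: R] f.
  apply: measurable_funX; apply: measurable_funX.
  apply: measurableT_comp; first exact: measurable_sqrtr.
  by apply: measurableT_comp => //; exact: measurable_ln.
have -> : (\int[P]_t ((Z t ^+ 2) ^+ 4)%:E = \int[P]_t (EFin \o f \o Psi) t)%E.
  apply: ae_eq_integral => //.
  - by apply/measurable_EFinP; exact: measurable_funX.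
  - by apply/measurable_EFinP; exact: measurableT_comp.
  - by apply: filterS Z_def => t Zt _; rewrite /= Zt.
rewrite -(ge0_integral_distribution Psi (f := EFin \o f))//; last first.
  exact/measurable_EFinP.
(* [uniform_prob] is a measure for the sigma-algebra generated by the intervals,
   the law of [Psi] for the Borel structure of [R]; the identity transports the
   former to the latter. *)
pose U := uniform_prob (ltr01 : (0 : R) < 1).
pose idR : measurableTypeR R -> R := idfun.
have midR : @measurable_fun _ _ (measurableTypeR R) R setT idR.
  by move=> _ A mA; rewrite setTI.
pose idU : {RV U >-> R} := HB.pack idR (isMeasurableFun.Build _ _ _ _ idR midR).
rewrite (eq_measure_integral (distribution U idU)); last first.
  by move=> A mA _; exact: Psi_law.
rewrite ge0_integral_distribution//; last exact/measurable_EFinP.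
rewrite integral_uniform//; last exact/measurable_EFinP.
rewrite subr0 invr1 mul1e -integral_itv_obnd_cbnd; last first.
  by apply/measurable_EFinP; exact: measurable_funTS.
have [c c0 Hc] := @ln4_le R.
apply: (@le_lt_trans _ _ (\int[lebesgue_measure]_(u in `]0%R, 1%R])
    (c%:E * (u `^ (- 2^-1))%:E))%E); last first.
  rewrite ge0_integralZl_EFin//.
  - by rewrite lte_mul_pinfty// integral_rsqrt_lty.
  - by move=> u _; rewrite lee_fin powR_ge0.
  - by apply/measurable_EFinP; apply: measurable_funTS; exact: measurable_powR.
apply: ge0_le_integral => //.
- by move=> u _; rewrite lee_fin.
- by apply/measurable_EFinP; exact: measurable_funTS.
- apply/measurable_EFinP; apply: measurable_funM => //.
  by apply: measurable_funTS; exact: measurable_powR.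
- move=> u; rewrite /= in_itv/= => u01.
  rewrite -EFinM lee_fin /f sqr_sqrtr ?Hc//.
  by rewrite oppr_ge0 ln_le0//; case/andP: u01.
Qed.

End Fourth_moments.

(** * Bounds on the germs and on the matrices *)

Section Germ_bounds.
Context {R : realType} (nus : nat) (nus_even : ~~ odd nus).
Variables (chi : 'rV[R]_3 -> R) (delta_s : R).
Variable q : idx nus./2 -> 'M[R]_(3, nus./2) -> R -> R.

Lemma chiT_le1 y b : chiT chi q delta_s nus_even y b <= 1.
Proof.
rewrite /chiT; set s := \sum_(_ | _) _.
have s_ge : a_full chi q delta_s nus_even y b ^+ 2 <= s.
  by rewrite /s (bigD1 b)//= lerDl sumr_ge0// => i _; exact: sqr_ge0.
have : 0 <= s by apply: le_trans s_ge; exact: sqr_ge0.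
rewrite le_eqVlt => /predU1P[<-|s0]; first by rewrite invr0 mulr0.
by rewrite ler_pdivrMr// mul1r.
Qed.

(** The bound is uniform in [x] and [S]: cosines and normalized weights are at
    most 1, whatever their arguments. *)
Lemma sqr_germ_le x S (z phi : idx nus -> R) :
  germ chi q delta_s nus_even x S z phi ^+ 2 <=
  #|{: idx nus}|%:R * (2 * \sum_b z b ^+ 2).
Proof.
apply: le_trans (sqr_sum_le _) _.
rewrite ler_wpM2l ?ler0n// mulr_sumr; apply: ler_sum => b _.
rewrite !exprMn -[leRHS]mulr1.
rewrite ler_pM ?sqr_ge0 ?(mulr_ge0 (sqr_ge0 _) (sqr_ge0 _))//.
  rewrite ler_wpM2r ?sqr_ge0//.
  have [c0|c0] := leP 0 (2 * chiT chi q delta_s nus_even S.2 b).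
    by rewrite sqr_sqrtr// ler_piMr// chiT_le1.
  by rewrite ltr0_sqrtr// expr0n.
Qed.

End Germ_bounds.

Section Matrix_bounds.
Context {R : realType}.
Variable delta_c : R.
Hypothesis delta_c_bounds : 0 < delta_c < Num.sqrt (7 / 11).
Implicit Types G : 'I_6 -> 'I_6 -> R.

Lemma sigma_gt0 : 0 < sigma delta_c.
Proof. by case/andP: delta_c_bounds => d0 _; rewrite divr_gt0// sqrtr_gt0. Qed.

Lemma alpha_gt1 (m : 'I_6) : 1 < alpha delta_c m.+1.
Proof.
case/andP: delta_c_bounds => d0 d1.
have d2 : delta_c ^+ 2 < 7 / 11.
  rewrite -[ltRHS]sqr_sqrtr; last by lra.
  by rewrite ltrXn2r// ?nnegrE ?sqrtr_ge0 ?ltW.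
have dsq0 : 0 < delta_c ^+ 2 by rewrite exprn_gt0.
have m6 : (m.+1)%:R <= 6 :> R by rewrite (ler_nat _ _ 6).
rewrite /alpha /sigma exprMn exprVn sqr_sqrtr//.
have -> : 1 / (2 * (delta_c ^+ 2 / 7)) = 7 / 2 / delta_c ^+ 2.
  by field; rewrite gt_eqF.
have : 11 / 2 < 7 / 2 / delta_c ^+ 2 by rewrite ltr_pdivlMr//; lra.
lra.
Qed.

Lemma Lmat_trig G : is_trig_mx (Lmat delta_c G)^T.
Proof.
apply/is_trig_mxP => i j ij; rewrite !mxE ltnNge (ltnW ij)/=.
by case: eqP ij => // ->; rewrite ltnn.
Qed.

Lemma Lmat_diag_gt0 G i : 0 < Lmat delta_c G i i.
Proof.
rewrite mxE ltnn eqxx mulr_gt0 ?sigma_gt0// sqrtr_gt0 mulr_gt0//.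
exact/h_gt0/alpha_gt1.
Qed.

Lemma sym_posdef_Cmat G : sym_posdef (Cmat delta_c G).
Proof. by apply: sym_posdef_gram; [exact: Lmat_trig|exact: Lmat_diag_gt0]. Qed.

(** The squared diagonal entries of [L] are [2 * h] up to [sigma ^+ 2], and [h]
    grows at most quadratically, so that all entries of [L] obey the bound
    that is obvious above the diagonal. *)
Lemma frobenius_Cmat_le : exists2 B : R, 0 <= B & forall G,
  frobenius (Cmat delta_c G) <=
  B + 4 * sigma delta_c ^+ 2 *
    \sum_(m : 'I_6) \sum_(n : 'I_6 | (m <= n)%N) G m n ^+ 2.
Proof.
have /choice[A HA] : forall m : 'I_6, exists A, 0 <= A /\
    forall b, h b (alpha delta_c m.+1) <= 2 * b ^+ 2 + A.
  by move=> m; have [A A0 HA] := h_le (alpha_gt1 m); exists A.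
set s := sigma delta_c ^+ 2; have s0 : 0 <= s := sqr_ge0 _.
exists (\sum_(m : 'I_6) \sum_(n : 'I_6 | (m <= n)%N) s * (2 * A m)).
  apply: sumr_ge0 => m _; apply: sumr_ge0 => n _.
  by rewrite mulr_ge0// mulr_ge0//; have [] := HA m.
move=> G; apply: (le_trans (frobenius_gram_le _)).
rewrite mulr_sumr -big_split/=; apply: ler_sum => m _.
rewrite mulr_sumr -big_split/= [leRHS]big_mkcond/=; apply: ler_sum => n _.
have [A0 hA] := HA m; rewrite mxE ltn_neqAle.
have [mn|] := ifPn; last first.
  case: (leqP m n) => [mn|]; last first.
    by move=> mn _; rewrite ifF ?expr0n//; apply/eqP => e; rewrite e ltnn in mn.
  rewrite andbT negbK => /eqP/val_inj <-; rewrite eqxx.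
  rewrite exprMn sqr_sqrtr; last by rewrite mulr_ge0// h_ge0// alpha_gt1.
  by have := ler_wpM2l s0 (hA (G m m)); rewrite -/s; lra.
case/andP: mn => _ ->; rewrite exprMn -/s.
by have := mulr_ge0 s0 A0; have := mulr_ge0 s0 (sqr_ge0 (G m n)); lra.
Qed.

End Matrix_bounds.

(** * Measurability of the random field *)

Section Measurability.
Context {R : realType} {d : measure_display} {T : measurableType d}.

Lemma measurable_frobenius n (M : T -> 'M[R]_n) :
  (forall i j, measurable_fun [set: T] (fun t => M t i j)) ->
  measurable_fun [set: T] (fun t => frobenius (M t)).
Proof.
move=> mM; apply: measurableT_comp; first exact: measurable_sqrtr.
apply: measurable_sum => i; apply: measurable_sum => j.
exact: measurable_funX.
Qed.

Lemma measurable_Cmat (delta_c : R) (G : T -> 'I_6 -> 'I_6 -> R) :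
  0 < delta_c < Num.sqrt (7 / 11) ->
  (forall m n, measurable_fun [set: T] (fun t => G t m n)) ->
  forall i j, measurable_fun [set: T] (fun t => Cmat delta_c (G t) i j).
Proof.
move=> dc mG i j.
have mL m n : measurable_fun [set: T] (fun t => Lmat delta_c (G t) m n).
  under eq_fun do rewrite mxE.
  case: (m < n)%N => /=; first by apply: measurable_funM.
  case: (m == n) => /=; last exact: measurable_cst.
  apply: measurable_funM => //.
  apply: measurableT_comp; first exact: measurable_sqrtr.
  apply: measurable_funM => //.
  exact: measurableT_comp (measurable_h (alpha_gt1 dc m)) (mG m m).
under eq_fun do rewrite mxE; apply: measurable_sum => k.
apply: measurable_funM; last exact: mL.
by under eq_fun do rewrite mxE; exact: mL.
Qed.

Lemma measurable_germ nus (nus_even : ~~ odd nus) chi delta_s q x S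
    (Z Phi : T -> idx nus -> R) :
  (forall b, measurable_fun [set: T] (fun t => Z t b)) ->
  (forall b, measurable_fun [set: T] (fun t => Phi t b)) ->
  measurable_fun [set: T]
    (fun t => germ chi q delta_s nus_even x S (Z t) (Phi t)).
Proof.
move=> mZ mPhi; apply: measurable_sum => b.
apply: measurable_funM; first by apply: measurable_funM.
apply: measurableT_comp; last by apply: measurable_funD.
by apply: continuous_measurable_fun; exact: continuous_cos.
Qed.

End Measurability.

(** * The random bound *)

Theorem proposition4
  (R : realType) (d : measure_display) (T : measurableType d)
  (P : probability T R)
  (* spectral discretization *)
  (nus : nat) (nus_ge2 : (2 <= nus)%N) (nus_even : ~~ odd nus)
  (chi : 'rV[R]_3 -> R)
  (chi_ge0 : forall t : 'rV[R]_3, 0 <= chi t)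
  (chi_cont : continuous chi)
  (chi_supp : closure [set t | chi t != 0] =
              [set t : 'rV[R]_3 | forall j, -1 <= t 0 j <= 1])
  (chi_int : (\int[lebesgue_measure \x lebesgue_measure \x lebesgue_measure]_t
                 (chi (\row_(j < 3) [:: t.1.1; t.1.2; t.2]`_j))%:E = 1)%E)
  (chi_even : forall t : 'rV[R]_3, chi (- t) = chi t)
  (chi_quadrant : forall (t : 'rV[R]_3) (i : 'I_3),
     chi (\row_j (if j == i then - t 0 j else t 0 j)) = chi t)
  (eps_s : R) (eps_s01 : 0 < eps_s < 1)
  (chiD_sum : `|\sum_(b : idx nus) chiD nus chi (fun j => b j) - 1| <= eps_s)
  (* parameterization *)
  (delta_s : R) (delta_s_gt0 : 0 < delta_s)
  (q : idx nus./2 -> 'M[R]_(3, nus./2) -> R -> R)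
  (q_cont : forall b, {within Cy, continuous (fun y => q b y delta_s)})
  (q_mean : forall b, q b y_mean delta_s = 1)
  (a_nondeg : forall y, Cy y ->
     0 < \sum_(b : idx nus) a_full chi q delta_s nus_even y b ^+ 2)
  (wmin wmax : 'rV[R]_3)
  (w_bounds : forall j, 0 < wmin 0 j < wmax 0 j)
  (* random germs *)
  (Z Phi Psi : 'I_6 -> 'I_6 -> idx nus -> {RV P >-> R})
  (Psi_law : forall (m n : 'I_6) b, (m <= n)%N -> uniform_law ltr01 (Psi m n b))
  (Z_def : forall (m n : 'I_6) b, (m <= n)%N ->
     {ae P, forall t, Z m n b t = Num.sqrt (- ln (Psi m n b t))})
  (Phi_law : forall (m n : 'I_6) b, (m <= n)%N -> uniform_law (twopi_gt0 R) (Phi m n b))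
  (germs_indep : mutually_independent (germ_family Z Phi))
  (delta_c : R) (delta_c_bounds : 0 < delta_c < Num.sqrt (7 / 11)) :
  let C := Cfield Z Phi chi q delta_s nus_even delta_c in
  exists GammaC : {RV P >-> R},
    [/\ forall t, 0 < GammaC t,
        ('E_P[fun t => (GammaC t ^+ 2)%R] < +oo)%E,
        ('E_P[fun t => (GammaC t ^+ 4)%R] < +oo)%E
      & forall S, CS wmin wmax S ->
        [/\ matrix_random_field (C S),
            forall x t, sym_posdef (C S x t),
            second_order P (C S),
            forall x, {ae P, forall t, frobenius (C S x t) <= GammaC t}
          & forall (om om' : 'cV[R]_6) (x : 'rV[R]_3),
              {ae P, forall t, `|dotv (C S x t *m om) om'| <=
                               GammaC t * norm2 om * norm2 om'}]].
Proof.
move=> C.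
have [B B0 HB] := frobenius_Cmat_le delta_c_bounds.
set s := 4 * sigma delta_c ^+ 2 in HB.
have s0 : 0 <= s by rewrite mulr_ge0// sqr_ge0.
(* The factor 2 bounds the squared coefficients [2 * chiT], the factor [N] comes
   from squaring a sum of [N] terms, and 1 makes the bound positive. *)
pose N : R := #|{: idx nus}|%:R.
pose X t : R := \sum_(m : 'I_6) \sum_(n : 'I_6 | (m <= n)%N)
  \sum_b Z m n b t ^+ 2.
pose Y t : R := 1 + B + s * (2 * N) * X t.
have X0 t : 0 <= X t.
  apply: sumr_ge0 => m _; apply: sumr_ge0 => n _; apply: sumr_ge0 => b _.
  exact: sqr_ge0.
have momY : finite_moment4 P Y.
  apply: finite_moment4D; first exact: finite_moment4_cst.
  apply: finite_moment4Z; apply: finite_moment4_sum => m _.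
  apply: finite_moment4_sum => n mn; apply: finite_moment4_sum => b _.
  exact: finite_moment4_rayleigh (Psi_law m n b mn) (Z_def m n b mn).
have [mY _] := momY.
have [Y4 Y2] := finite_moment4_expectation momY.
have CY S x t : frobenius (C S x t) <= Y t.
  rewrite /Y -addrA; apply: (le_trans (HB _)).
  rewrite addrA [1 + B]addrC -addrA lerD2l.
  apply: (@le_trans _ _ (s * (2 * N) * X t)); last by rewrite lerDr.
  rewrite -mulrA ler_wpM2l// mulr_sumr; apply: ler_sum => m _.
  rewrite mulr_sumr; apply: ler_sum => n _.
  by rewrite -mulrA mulrCA; exact: sqr_germ_le.
have mC S x i j : measurable_fun [set: T] (fun t => C S x t i j).
  apply: measurable_Cmat => // m n; apply: measurable_germ => b;
  exact: measurable_funP.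
pose GammaC : {RV P >-> R} := HB.pack Y (isMeasurableFun.Build _ _ _ _ Y mY).
have Y0 t : 0 < Y t.
  have N0 : 0 <= N by rewrite ler0n.
  have sX0 : 0 <= s * (2 * N) * X t.
    by apply: mulr_ge0 => //; apply: mulr_ge0 => //; exact: mulr_ge0.
  by rewrite /Y; lra.
exists GammaC; split => //.
move=> S _; split.
- by move=> x i j; exact: mC.
- by move=> x t; exact: sym_posdef_Cmat.
- move=> x; apply: le_lt_trans Y2; apply: expectation_le.
  + by apply: measurable_funX; apply: measurable_frobenius => i j; exact: mC.
  + exact: measurable_funX.
  + by move=> t; exact: sqr_ge0.
  + by move=> t; exact: sqr_ge0.
  + by apply: aeW => t; rewrite lerXn2r ?nnegrE ?frobenius_ge0 ?CY ?ltW.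
- by move=> x; apply: aeW => t; exact: CY.
- move=> om om' x; apply: aeW => t.
  apply: (le_trans (dotv_mulmx_le _ _ _)).
  by rewrite -!mulrA ler_wpM2r ?mulr_ge0 ?sqrtr_ge0 ?CY.
Qed.
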